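(* Let $R$ be a commutative ring with identity, let $M_1, M_2, N$ be $R$-modules, and let $f_i : M_i \to N$ ($i=1,2$) be $R$-linear maps. Denote by $\mathbf{0}$ and $\mathbf{I}$ respectively the zero linear map and the identity map (with the appropriate source and target modules in each item). Then: (i) $\ker(\mathbf{0}\mid f_2)=\ker(f_2)$. (ii) If $f_1$ is onto, then $\ker(f_1\mid f_2)=M_2$. (iii) $\ker(\mathbf{0}\mid\mathbf{I})=0$ (here $M_2=N$). (iv) $\ker(f_1\mid\mathbf{0})=M_2$. (v) In general, if $\operatorname{Im}(f_2)\subseteq\operatorname{Im}(f_1)$, then $\ker(f_1\mid f_2)=M_2$. (vi) If $\Psi_2$ is an automorphism of $M_2$, then $m_2\mapsto\Psi_2(m_2)$ is an isomorphism $\ker(f_1\mid f_2\Psi_2)\to\ker(f_1\mid f_2)$. (vii) If $\Psi_2$ is an automorphism of $M_2$, then $\ker(f_1\mid f_2\Psi_2)=\Psi_2^{-1}(\ker(f_1\mid f_2))$. (viii) If $\Psi_1$ is an automorphism of $M_1$, then $\ker(f_1\Psi_1\mid f_2)=\ker(f_1\mid f_2)$. (ix) If $\Psi$ is an automorphism of $N$, then $\ker(\Psi f_1\mid f_2)=\ker(f_1\mid\Psi^{-1}f_2)$.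
   Context: For $R$-linear maps $f_1:M_1\to N$ and $f_2:M_2\to N$, the kernel of the pair is the $R$-submodule of $M_2$ given by $\ker(f_1\mid f_2)=\{m_2\in M_2 \mid \exists m_1\in M_1 : f_1(m_1)+f_2(m_2)=0\}$. Juxtaposition of maps denotes composition; automorphisms are $R$-module automorphisms. *)

(* Defs.v *)
From HB Require Import structures.
From mathcomp Require Import all_boot all_algebra.
From mathcomp Require Import boolp classical_sets.

Set Implicit Arguments.
Unset Strict Implicit.
Unset Printing Implicit Defensive.

Import GRing.Theory.
Local Open Scope ring_scope.
Local Open Scope classical_set_scope.

(* The base ring is a [comPzRingType], so that the zero ring is allowed. *)

Definition ker (R : comPzRingType) (U V : lmodType R) (f : {linear U -> V}) :
  set U := [set u | f u = 0].

Definition ker_pair (R : comPzRingType) (M1 M2 N : lmodType R)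
    (f1 : {linear M1 -> N}) (f2 : {linear M2 -> N}) : set M2 :=
  [set m2 | exists m1, f1 m1 + f2 m2 = 0].

(* [ker_pair f1 f2] as an R-module, with the structure inherited from [M2]. *)
Section KerPairModule.
Variables (R : comPzRingType) (M1 M2 N : lmodType R).
Variables (f1 : {linear M1 -> N}) (f2 : {linear M2 -> N}).

Definition in_ker_pair : pred M2 := fun m2 => m2 \in ker_pair f1 f2.

Lemma ker_pair_submod_closed : submod_closed in_ker_pair.
Proof.
split=> [|a x y].
  by rewrite unfold_in /in_ker_pair; apply/mem_set; exists 0;
     rewrite !linear0 addr0.
rewrite !unfold_in /in_ker_pair => /set_mem[u fu] /set_mem[v fv].
apply/mem_set; exists (a *: u + v).
by rewrite !linearP addrACA -scalerDr fu fv scaler0 addr0.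
Qed.

HB.instance Definition _ :=
  GRing.isSubmodClosed.Build R M2 in_ker_pair ker_pair_submod_closed.

Definition ker_pair_module : Type := {m2 : M2 | in_ker_pair m2}.

HB.instance Definition _ := SubChoice.on ker_pair_module.
HB.instance Definition _ := [SubChoice_isSubLmodule of ker_pair_module by <:].

End KerPairModule.

(* R-module isomorphisms as linear maps with a two-sided inverse,
   which is then linear as well (instance below). *)
Record liso (R : comPzRingType) (U V : lmodType R) := LIso {
  liso_fun :> {linear U -> V};
  liso_inv : V -> U;
  liso_funK : cancel liso_fun liso_inv;
  liso_invK : cancel liso_inv liso_fun }.

Notation lauto M := (liso M M).

HB.instance Definition _ (R : comPzRingType) (U V : lmodType R)
    (e : liso U V) :=
  GRing.isLinear.Build R V U *:%R (liso_inv e)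
    (can2_linear (liso_funK e) (liso_invK e)).

(* Main.v *)
Require Import Defs.
From HB Require Import structures.
From mathcomp Require Import all_boot all_algebra.
From mathcomp Require Import boolp classical_sets.

(** The kernel of the pair is a preimage: since [range f1] is closed under
opposites, [f1 m1 + f2 m2 = 0] is solvable in [m1] exactly when [f2 m2] lies in
[range f1] ([ker_pairE]). Only the image of [f1] therefore matters, and every
item becomes a remark on images and preimages of sets: the items with a zero or
onto map compute the preimage of [{0}] or of a set containing [range f2];
an automorphism of [M1] does not change [range f1]; one of [N] moves across the
membership [f2 m2 \in range f1]; one of [M2] pulls the whole preimage back.
The isomorphism induced by [Psi2] is [Psi2] itself, restricted to two
submodules that correspond under it ([liso_ker_pair]). *)

Set Implicit Arguments.
Unset Strict Implicit.
Unset Printing Implicit Defensive.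

Import GRing.Theory.
Local Open Scope ring_scope.
Local Open Scope classical_set_scope.

(** The witness [m1] changes sign between the two descriptions. *)
Lemma ker_pairE (R : comPzRingType) (M1 M2 N : lmodType R)
    (f1 : {linear M1 -> N}) (f2 : {linear M2 -> N}) :
  ker_pair f1 f2 = f2 @^-1` range f1.
Proof.
apply/seteqP; split=> m2 /= [m1].
  by move/eqP; rewrite addrC addr_eq0 => /eqP ->; exists (- m1); rewrite ?linearN.
by move=> _ e; exists (- m1); rewrite linearN e addNr.
Qed.

Lemma range_linear0 (R : comPzRingType) (M N : lmodType R) :
  range (\0 : {linear M -> N}) = [set 0].
Proof. by apply/seteqP; split=> [_ [m _ <-]//|_ ->]; exists 0. Qed.

Section KerPair.
Variables (R : comPzRingType) (M1 M2 N : lmodType R).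
Variables (f1 : {linear M1 -> N}) (f2 : {linear M2 -> N}).

Lemma ker_pair_full :
  range f2 `<=` range f1 -> ker_pair f1 f2 = [set: M2].
Proof.
by move=> f21; rewrite ker_pairE -subTset => m2 _; apply: f21; exists m2.
Qed.

(** Precomposing [f1] with a bijection does not change its image. *)
Lemma ker_pair_comp_autol (Psi1 : lauto M1) :
  ker_pair (f1 \o Psi1) f2 = ker_pair f1 f2.
Proof.
rewrite !ker_pairE; congr (_ @^-1` _).
apply/seteqP; split=> _ [m _ <-]; first by exists (Psi1 m).
by exists (liso_inv Psi1 m); rewrite //= liso_invK.
Qed.

(** The left side is the preimage of [ker_pair f1 f2] under [Psi2], and the
preimage under a bijection is the image under its inverse. *)
Lemma ker_pair_comp_autor (Psi2 : lauto M2) :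
  ker_pair f1 (f2 \o Psi2) = liso_inv Psi2 @` ker_pair f1 f2.
Proof.
apply/seteqP; split=> [m km|_ [m km <-]].
  by exists (Psi2 m); rewrite ?liso_funK.
by case: km => m1 km; exists m1; rewrite /= liso_invK.
Qed.

(** [f2 m2 = Psi (f1 m1)] and [liso_inv Psi (f2 m2) = f1 m1] are the same
equation, so the same [m1] serves on both sides. *)
Lemma ker_pair_auto_comp (Psi : lauto N) :
  ker_pair (Psi \o f1) f2 = ker_pair f1 (liso_inv Psi \o f2).
Proof.
rewrite !ker_pairE; apply/seteqP; split=> m2 /= [m1 _ e]; exists m1 => //.
  by rewrite -e /= liso_funK.
by rewrite /= e liso_invK.
Qed.

End KerPair.

Section KerPairIso.
Variables (R : comPzRingType) (M1 M2 N : lmodType R).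
Variables (f1 : {linear M1 -> N}) (f2 : {linear M2 -> N}) (Psi2 : lauto M2).

Let K := ker_pair_module f1 (f2 \o Psi2).
Let L := ker_pair_module f1 f2.

(** Membership of [m] in [ker_pair f1 (f2 \o Psi2)] and membership of [Psi2 m] in
[ker_pair f1 f2] are convertible, as both say that
[f1 m1 + f2 (Psi2 m) = 0] has a solution [m1]. *)
Lemma ker_pair_fun_subproof (x : K) : in_ker_pair f1 f2 (Psi2 (val x)).
Proof. exact: (valP x). Qed.

Lemma ker_pair_inv_subproof (y : L) :
  in_ker_pair f1 (f2 \o Psi2) (liso_inv Psi2 (val y)).
Proof.
apply/mem_set; rewrite ker_pair_comp_autor.
by exists (val y) => //; apply/set_mem/(valP y).
Qed.

Definition ker_pair_fun (x : K) : L := Sub _ (ker_pair_fun_subproof x).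
Definition ker_pair_inv (y : L) : K := Sub _ (ker_pair_inv_subproof y).

Fact ker_pair_fun_linear : linear ker_pair_fun.
Proof. by move=> a x y; apply: val_inj; rewrite /= !linearP. Qed.

HB.instance Definition _ :=
  GRing.isLinear.Build R K L *:%R ker_pair_fun ker_pair_fun_linear.

Lemma ker_pair_funK : cancel ker_pair_fun ker_pair_inv.
Proof. by move=> x; apply: val_inj; rewrite /= liso_funK. Qed.

Lemma ker_pair_invK : cancel ker_pair_inv ker_pair_fun.
Proof. by move=> y; apply: val_inj; rewrite /= liso_invK. Qed.

Definition liso_ker_pair : liso K L := LIso ker_pair_funK ker_pair_invK.

End KerPairIso.

Theorem proposition2p5 (R : comPzRingType) (M1 M2 N : lmodType R)
    (f1 : {linear M1 -> N}) (f2 : {linear M2 -> N}) :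
  (ker_pair (\0 : {linear M1 -> N}) f2 = ker f2) /\
  (range f1 = [set: N] -> ker_pair f1 f2 = [set: M2]) /\
  (ker_pair (\0 : {linear M1 -> N}) (idfun : {linear N -> N}) = [set 0]) /\
  (ker_pair f1 (\0 : {linear M2 -> N}) = [set: M2]) /\
  (range f2 `<=` range f1 -> ker_pair f1 f2 = [set: M2]) /\
  (forall Psi2 : lauto M2,
     exists phi : liso (ker_pair_module f1 (f2 \o Psi2))
                       (ker_pair_module f1 f2),
       forall m2, val (phi m2) = Psi2 (val m2)) /\
  (forall Psi2 : lauto M2,
     ker_pair f1 (f2 \o Psi2) = liso_inv Psi2 @` ker_pair f1 f2) /\
  (forall Psi1 : lauto M1, ker_pair (f1 \o Psi1) f2 = ker_pair f1 f2) /\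
  (forall Psi : lauto N,
     ker_pair (Psi \o f1) f2 = ker_pair f1 (liso_inv Psi \o f2)).
Proof.
split; first by rewrite ker_pairE range_linear0.
split; first by move=> f1T; apply: ker_pair_full; rewrite f1T.
split; first by rewrite ker_pairE range_linear0.
split.
  by apply: ker_pair_full; rewrite range_linear0 => _ ->; exists 0; rewrite ?linear0.
split; first exact: ker_pair_full.
split; first by move=> Psi2; exists (liso_ker_pair f1 f2 Psi2).
split; first exact: ker_pair_comp_autor.
split; first exact: ker_pair_comp_autol.
exact: ker_pair_auto_comp.
Qed.
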